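(* Consider two bodies of mass $1$ on the unit sphere $S^2\subset\mathbb{R}^3$, with positions $\mathbf{q}_1(t),\mathbf{q}_2(t)$, interacting through the potential $V=-\cot q$, where $q\in(0,\pi)$ is the angle between $\mathbf{q}_1$ and $\mathbf{q}_2$. Along any collision trajectory with (conserved) angular momentum vector $\mathbf{L}\neq0$, the two bodies move towards the equator lying in the plane through the origin perpendicular to $\mathbf{L}$; that is, $\langle\mathbf{q}_1(t),\mathbf{L}\rangle\to0$ and $\langle\mathbf{q}_2(t),\mathbf{L}\rangle\to0$ as $t$ tends to the collision time $t^*$.
   Context: The dynamics is the Hamiltonian flow on the cotangent bundle $T^*(S^2\times S^2\setminus\Delta)$ (with its canonical symplectic structure), where $\Delta$ is the set of pairs of equal or antipodal points, of $\mathcal{H}=\frac12\|\mathbf{p}_1\|^2+\frac12\|\mathbf{p}_2\|^2-\cot q$, where $\cos q=\langle\mathbf{q}_1,\mathbf{q}_2\rangle$, $q\in(0,\pi)$. Here $\mathbf{p}_i\in\mathbb{R}^3$ with $\langle\mathbf{p}_i,\mathbf{q}_i\rangle=0$ is the momentum of the $i$-th body, so $\dot{\mathbf{q}}_i=\mathbf{p}_i$. By rotational symmetry the total angular momentum $\mathbf{L}=\mathbf{q}_1\times\mathbf{p}_1+\mathbf{q}_2\times\mathbf{p}_2$ is conserved. A collision trajectory is a solution on $[0,t^* )$, $t^*\in(0,+\infty]$, with $\mathbf{q}_1(t)-\mathbf{q}_2(t)\to0$ as $t\to t^*$. *)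

(* Defs.v *)
From HB Require Import structures.
From mathcomp Require Import all_boot all_order all_algebra.
From mathcomp Require Import all_classical all_reals all_analysis.

Set Implicit Arguments.
Unset Strict Implicit.
Unset Printing Implicit Defensive.

Import Order.TTheory GRing.Theory Num.Theory.
Import numFieldNormedType.Exports.

Local Open Scope classical_set_scope.
Local Open Scope ring_scope.

Definition dot (R : realType) (u v : 'rV[R]_3) : R := (u *m v^T) 0 0.

(* Indices are added modulo 3 in 'I_3. *)
Definition cross (R : realType) (u v : 'rV[R]_3) : 'rV[R]_3 :=
  \row_(i < 3) (u 0 (i + 1) * v 0 (i + 2%:R) - u 0 (i + 2%:R) * v 0 (i + 1)).

(* ((q1, q2), (p1, p2)): positions and momenta in the ambient space of the
   two bodies.  The round metric identifies covectors at q_i with vectors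
   orthogonal to q_i. *)
Definition state (R : realType) : Type :=
  (('rV[R]_3 * 'rV[R]_3) * ('rV[R]_3 * 'rV[R]_3))%type.

Definition pos1 (R : realType) (x : state R) : 'rV[R]_3 := x.1.1.
Definition pos2 (R : realType) (x : state R) : 'rV[R]_3 := x.1.2.
Definition mom1 (R : realType) (x : state R) : 'rV[R]_3 := x.2.1.
Definition mom2 (R : realType) (x : state R) : 'rV[R]_3 := x.2.2.

(* The cotangent bundle of (S^2 x S^2) minus equal or antipodal pairs, as a
   submanifold of the ambient space. *)
Definition phase_space (R : realType) : set (state R) :=
  [set x | [/\ dot (pos1 x) (pos1 x) = 1 /\ dot (pos2 x) (pos2 x) = 1,
               pos1 x <> pos2 x /\ pos1 x <> - pos2 x,
               dot (mom1 x) (pos1 x) = 0 & dot (mom2 x) (pos2 x) = 0]].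

(* Tangent space of phase_space at x: the linearization at x of the equations
   |q_i|^2 = 1 and <p_i, q_i> = 0. *)
Definition tangent (R : realType) (x : state R) : set (state R) :=
  [set v | [/\ dot (pos1 x) (pos1 v) = 0, dot (pos2 x) (pos2 v) = 0,
               dot (mom1 v) (pos1 x) + dot (mom1 x) (pos1 v) = 0 &
               dot (mom2 v) (pos2 x) + dot (mom2 x) (pos2 v) = 0]].

(* The form \sum_i dq_i /\ dp_i.  The tautological 1-form of the cotangent
   bundle is the restriction of \sum_i <p_i, dq_i>, so the canonical symplectic
   form is the restriction of omega to tangent vectors; with this sign the
   Hamiltonian vector field X is given by omega(X, .) = dH. *)
Definition omega (R : realType) (v w : state R) : R :=
  dot (pos1 v) (mom1 w) + dot (pos2 v) (mom2 w)
  - dot (mom1 v) (pos1 w) - dot (mom2 v) (pos2 w).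

Definition cot (R : realType) (a : R) : R := cos a / sin a.

(* For unit vectors that are neither equal nor antipodal, this is the angle
   in ]0, pi[ whose cosine is <q1, q2>. *)
Definition angle (R : realType) (x : state R) : R :=
  acos (dot (pos1 x) (pos2 x)).

(* Defined on the whole ambient space, and smooth near phase_space. *)
Definition hamiltonian (R : realType) (x : state R) : R :=
  2^-1 * dot (mom1 x) (mom1 x) + 2^-1 * dot (mom2 x) (mom2 x) - cot (angle x).

Definition angular_momentum (R : realType) (x : state R) : 'rV[R]_3 :=
  cross (pos1 x) (mom1 x) + cross (pos2 x) (mom2 x).

(* X is the value at x of the Hamiltonian vector field on phase_space. *)
Definition hamiltonian_vector (R : realType) (x X : state R) : Prop :=
  tangent x X /\
  forall v : state R, tangent x v -> omega X v = 'D_v (@hamiltonian R) x.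

Definition time_interval (R : realType) (T : \bar R) : set R :=
  [set t | 0 <= t /\ (t%:E < T)%E].

(* The derivative at t of a curve defined on D (one-sided at an endpoint). *)
Definition has_derivative_within (R : realType) (D : set R)
    (g : R -> state R) (t : R) (v : state R) : Prop :=
  (fun s : R => (s - t)^-1 *: (g s - g t)) @ within D t^' --> v.

Definition is_solution (R : realType) (T : \bar R) (g : R -> state R) : Prop :=
  forall t : R, time_interval T t ->
    phase_space (g t) /\
    exists2 X : state R, hamiltonian_vector (g t) X &
      has_derivative_within (time_interval T) g t X.

(* The filter "t tends to T, with t < T"; it is only used for 0 < T, so that
   the value at -oo is irrelevant. *)
Definition to_time (R : realType) (T : \bar R) : set_system R :=
  match T with
  | r%:E => r^'-
  | +oo%E => +oo%R
  | -oo%E => -oo%R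
  end.

Definition is_collision_trajectory (R : realType) (T : \bar R)
    (g : R -> state R) : Prop :=
  [/\ (0 < T)%E, is_solution T g &
      (fun t => pos1 (g t) - pos2 (g t)) @ to_time T --> (0 : 'rV[R]_3)].

(* Main.v *)
Require Import Defs.
From HB Require Import structures.
From mathcomp Require Import all_boot all_order all_algebra.
From mathcomp Require Import all_classical all_reals all_analysis.
From mathcomp Require Import ring lra.

(* The height <q1, L> equals det(q1, q2, p2), so |<q1, L>| <= sin q |p2|, and
   conservation of the energy E bounds this by the square root of
   2 E sin^2 q + 2 sin q cos q, which tends to 0 as q -> 0; the two bodies play
   symmetric roles.  Conservation of E is omega(X, X) = 0, and conservation of L
   follows by pairing X with infinitesimal rotations, along which the
   Hamiltonian is stationary; the equations of motion are never written out. *)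

Import Order.TTheory GRing.Theory Num.Theory.
Import numFieldNormedType.Exports.

Local Open Scope classical_set_scope.
Local Open Scope ring_scope.

(** * Dot and cross products in coordinates *)

Section Vectors.
Variable R : realType.
Implicit Types u v w : 'rV[R]_3.

Lemma dotE u v :
  dot u v = u 0 0 * v 0 0 + u 0 1 * v 0 1 + u 0 2%:R * v 0 2%:R.
Proof.
rewrite /dot mxE !big_ord_recl big_ord0 !mxE addr0 addrA.
by do !congr (_ + _); congr (u _ _ * v _ _); apply/val_inj.
Qed.

Lemma crossE u v :
  [/\ cross u v 0 0 = u 0 1 * v 0 2%:R - u 0 2%:R * v 0 1,
      cross u v 0 1 = u 0 2%:R * v 0 0 - u 0 0 * v 0 2%:R &
      cross u v 0 2%:R = u 0 0 * v 0 1 - u 0 1 * v 0 0].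
Proof.
(* The indices in [cross] wrap around modulo 3; these four sums bring them back to 0, 1, 2. *)
have [e0 e1] : (1 + 2%:R = 0 :> 'I_3) /\ (1 + 1 = 2%:R :> 'I_3).
  by split; apply/val_inj.
have [e2 e3] : (2%:R + 1 = 0 :> 'I_3) /\ (2%:R + 2%:R = 1 :> 'I_3).
  by split; apply/val_inj.
by split; rewrite mxE ?add0r ?e0 ?e1 ?e2 ?e3.
Qed.

Lemma cross0E u v : cross u v 0 0 = u 0 1 * v 0 2%:R - u 0 2%:R * v 0 1.
Proof. by case: (crossE u v). Qed.

Lemma cross1E u v : cross u v 0 1 = u 0 2%:R * v 0 0 - u 0 0 * v 0 2%:R.
Proof. by case: (crossE u v). Qed.

Lemma cross2E u v : cross u v 0 2%:R = u 0 0 * v 0 1 - u 0 1 * v 0 0.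
Proof. by case: (crossE u v). Qed.

Definition coordE := (dotE, cross0E, cross1E, cross2E, mxE).

Lemma dotC u v : dot u v = dot v u.
Proof. by rewrite !dotE; ring. Qed.

Lemma dotDl u v w : dot (u + v) w = dot u w + dot v w.
Proof. by rewrite !coordE; ring. Qed.

Lemma dot_ge0 u : 0 <= dot u u.
Proof. by rewrite dotE; rewrite !addr_ge0// -expr2 sqr_ge0. Qed.

Lemma dot_eq0 u : dot u u = 0 -> u = 0.
Proof.
rewrite dotE => u0.
have s (a : R) := sqr_ge0 a.
have [z0 [z1 z2]] : u 0 0 ^+ 2 = 0 /\ u 0 1 ^+ 2 = 0 /\ u 0 2%:R ^+ 2 = 0.
  have := (s (u 0 0), s (u 0 1), s (u 0 2%:R)) => -[[]].
  by rewrite !expr2; lra.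
apply/rowP => i; rewrite mxE; apply/eqP.
have : i \in [:: 0; 1; 2%:R] by case: i => -[|[|[]]].
by rewrite !inE => /or3P[] /eqP ->; rewrite -sqrf_eq0 ?z0 ?z1 ?z2.
Qed.

(** Lagrange's identity. It gives Cauchy-Schwarz, and for unit vectors at angle q it evaluates |u x
    v|^2 as sin^2 q. *)
Lemma dot_cross_sqr u v :
  dot (cross u v) (cross u v) = dot u u * dot v v - dot u v ^+ 2.
Proof. by rewrite !coordE; ring. Qed.

Lemma dot_sqr_le u v : dot u v ^+ 2 <= dot u u * dot v v.
Proof. by rewrite -subr_ge0 -dot_cross_sqr dot_ge0. Qed.

(** For unit vectors |u + v|^2 = 2 + 2<u, v> and |u - v|^2 = 2 - 2<u, v>; both are nonnegative and
    vanish only in the excluded cases. *)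
Lemma dot_unit_bounds u v : dot u u = 1 -> dot v v = 1 ->
  u <> v -> u <> - v -> -1 < dot u v < 1.
Proof.
move=> u1 v1 uv uNv; apply/andP; split; rewrite lt_neqAle; apply/andP; split.
- apply/eqP => e; apply: uNv; apply/eqP; rewrite -subr_eq0; apply/eqP/dot_eq0.
  by move: u1 v1 e; rewrite !coordE; lra.
- by have := dot_ge0 (u + v); move: u1 v1; rewrite !coordE; lra.
- apply/eqP => e; apply: uv; apply/eqP; rewrite -subr_eq0; apply/eqP/dot_eq0.
  by move: u1 v1 e; rewrite !coordE; lra.
- by have := dot_ge0 (u - v); move: u1 v1; rewrite !coordE; lra.
Qed.

Lemma dot_crossA u v w : dot u (cross v w) = dot (cross u v) w.
Proof. by rewrite !coordE; ring. Qed.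

Lemma dot_cross_self u v : dot u (cross u v) = 0.
Proof. by rewrite !coordE; ring. Qed.

End Vectors.

(** * Differentials of the Hamiltonian and of the angular momentum *)

Section Curves.
Variable R : realType.

(** Stated coordinate by coordinate, so that the calculus rules for real functions apply
    directly. *)
Definition is_derive_row (t : R) (u : R -> 'rV[R]_3) (u' : 'rV[R]_3) :=
  forall i, is_derive t 1 (fun s => u s 0 i) (u' 0 i).

Definition is_derive_state (t : R) (c : R -> state R) (v : state R) :=
  [/\ is_derive_row t (fun s => pos1 (c s)) (pos1 v),
      is_derive_row t (fun s => pos2 (c s)) (pos2 v),
      is_derive_row t (fun s => mom1 (c s)) (mom1 v) &
      is_derive_row t (fun s => mom2 (c s)) (mom2 v)].

Lemma is_derive_mulr (t : R) (f g : R -> R) (a b : R) :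
  is_derive t 1 f a -> is_derive t 1 g b ->
  is_derive t 1 (fun s => f s * g s) (a * g t + f t * b).
Proof.
move=> fa gb; apply: is_derive_eq (is_deriveM fa gb) _.
by rewrite /GRing.scale /=; ring.
Qed.

Lemma is_derive_dot (t : R) u v (u' v' : 'rV[R]_3) :
  is_derive_row t u u' -> is_derive_row t v v' ->
  is_derive t 1 (fun s => dot (u s) (v s)) (dot u' (v t) + dot (u t) v').
Proof.
move=> du dv.
have -> : (fun s => dot (u s) (v s)) = (fun s => u s 0 0 * v s 0 0) +
    (fun s => u s 0 1 * v s 0 1) + (fun s => u s 0 2%:R * v s 0 2%:R).
  by apply/funext => s; rewrite dotE.
have d i := is_derive_mulr _ _ _ _ _ (du i) (dv i).
apply: is_derive_eq (is_deriveD (is_deriveD (d 0) (d 1)) (d 2%:R)) _.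
by rewrite !dotE; ring.
Qed.

Lemma is_derive_cross (t : R) u v (u' v' : 'rV[R]_3) :
  is_derive_row t u u' -> is_derive_row t v v' ->
  is_derive_row t (fun s => cross (u s) (v s)) (cross u' (v t) + cross (u t) v').
Proof.
move=> du dv i.
have -> : (fun s => cross (u s) (v s) 0 i) =
    (fun s => u s 0 (i + 1) * v s 0 (i + 2%:R)) -
    (fun s => u s 0 (i + 2%:R) * v s 0 (i + 1)).
  by apply/funext => s; rewrite mxE.
have d j k := is_derive_mulr _ _ _ _ _ (du j) (dv k).
apply: is_derive_eq (is_deriveB (d _ _) (d _ _)) _.
by rewrite !mxE; ring.
Qed.

(** Pairing with a fixed vector [e] makes the quantity real-valued, so that the mean value theorem
    can be applied to it. *)
Lemma is_derive_angular_momentum (t : R) c (v : state R) (e : 'rV[R]_3) :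
  is_derive_state t c v ->
  is_derive t 1 (fun s => dot (angular_momentum (c s)) e)
    (dot (cross (pos1 v) (mom1 (c t)) + cross (pos1 (c t)) (mom1 v) +
          (cross (pos2 v) (mom2 (c t)) + cross (pos2 (c t)) (mom2 v))) e).
Proof.
move=> [d1 d2 d3 d4].
have dL : is_derive_row t (fun s => angular_momentum (c s))
    (cross (pos1 v) (mom1 (c t)) + cross (pos1 (c t)) (mom1 v) +
     (cross (pos2 v) (mom2 (c t)) + cross (pos2 (c t)) (mom2 v))).
  move=> i; rewrite /angular_momentum.
  under [X in is_derive _ _ X]eq_fun => s do rewrite mxE.
  rewrite mxE.
  exact: is_deriveD (is_derive_cross _ _ _ _ _ d1 d3 i)
    (is_derive_cross _ _ _ _ _ d2 d4 i).
have de : is_derive_row t (fun=> e) 0 by move=> i; rewrite mxE; exact: is_derive_cst.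
apply: is_derive_eq (is_derive_dot _ _ _ _ _ dL de) _.
by rewrite [dot _ 0]dotE !mxE !mulr0 !addr0.
Qed.

Lemma phase_space_dot (x : state R) :
  phase_space x -> -1 < dot (pos1 x) (pos2 x) < 1.
Proof. by case=> -[u1 v1] [n1 n2] _ _; exact: dot_unit_bounds. Qed.

(** Minus the potential, as a function of d = cos q instead of q. *)
Definition cot_acos (d : R) := cot (acos d).

Lemma cot_acosE (d : R) : -1 < d < 1 -> cot_acos d = d / Num.sqrt (1 - d ^+ 2).
Proof.
move=> /andP[d1 d2]; rewrite /cot_acos /cot acosK ?sin_acos//.
- by rewrite (ltW d1) (ltW d2).
- by rewrite in_itv/= (ltW d1) (ltW d2).
Qed.

Lemma derivable_cot_acos (d : R) : -1 < d < 1 -> derivable cot_acos d 1.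
Proof.
move=> d1; have da := is_derive1_acos d1.
have dc := is_derive1_comp (is_derive_cos _) da.
have ds := is_derive1_comp (is_derive_sin _) da.
have s0 : (sin \o acos) d != 0.
  case/andP: d1 => d1 d2; rewrite /= sin_acos ?(ltW d1) ?(ltW d2)//.
  by rewrite gt_eqF// sqrtr_gt0; nra.
have := is_deriveM dc (is_deriveV s0 ds).
by case.
Qed.

(** The chain rule for dH at [x]. The derivative of the potential stays unevaluated: under rotations
    its cofactor, the variation of <q1, q2>, is zero. *)
Definition hamiltonian_diff (x v : state R) : R :=
  dot (mom1 x) (mom1 v) + dot (mom2 x) (mom2 v)
  - 'D_1 cot_acos (dot (pos1 x) (pos2 x)) *
    (dot (pos1 v) (pos2 x) + dot (pos1 x) (pos2 v)).

Lemma is_derive_hamiltonian (t : R) c (v : state R) :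
  phase_space (c t) -> is_derive_state t c v ->
  is_derive t 1 (fun s => hamiltonian (c s)) (hamiltonian_diff (c t) v).
Proof.
move=> /phase_space_dot xP [d1 d2 d3 d4].
have dV : is_derive t 1 (fun s => cot_acos (dot (pos1 (c s)) (pos2 (c s)))) _ :=
  is_derive1_comp (DeriveDef (derivable_cot_acos _ xP) erefl)
    (is_derive_dot _ _ _ _ _ d1 d2).
have half (f : R -> R) a : is_derive t 1 f a ->
    is_derive t 1 (fun s => 2^-1 * f s) (2^-1 * a).
  by move=> fa; exact: is_deriveZ.
have d33 := half _ _ (is_derive_dot _ _ _ _ _ d3 d3).
have d44 := half _ _ (is_derive_dot _ _ _ _ _ d4 d4).
apply: is_derive_eq (is_deriveB (is_deriveD d33 d44) dV) _.
rewrite /hamiltonian_diff (dotC _ (mom1 v)) (dotC _ (mom2 v)).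
by field.
Qed.

(** The directional derivative is the derivative at 0 along the line h v + x. This line may leave
    the phase space, but [is_derive_hamiltonian] asks for membership only at the time of
    differentiation. *)
Lemma derive_hamiltonian (x v : state R) :
  phase_space x -> 'D_v (@hamiltonian R) x = hamiltonian_diff x v.
Proof.
move=> xP.
have line (a b : R) : is_derive (0 : R) 1 (fun h : R => h * a + b) a.
  rewrite (_ : (fun h => _) = (fun h => id h * cst a h) + cst b)//.
  have dm := is_derive_mulr _ _ _ _ _ (is_derive_id (0 : R) 1)
    (is_derive_cst a (0 : R) 1).
  apply: is_derive_eq (is_deriveD dm (is_derive_cst b (0 : R) 1)) _.
  by rewrite mul1r mulr0 !addr0.
have dl : is_derive_state 0 (fun h => h *: v + x) v.
  by split=> i; under [X in is_derive _ _ X]eq_fun => s do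
    rewrite /pos1 /pos2 /mom1 /mom2 /= !mxE; exact: line.
have l0 : 0 *: v + x = x by rewrite scale0r add0r.
have dH := is_derive_hamiltonian (0 : R) (fun h => h *: v + x) v.
rewrite /= l0 in dH; have [_ <-] := dH xP dl.
rewrite /derive.
set f := (X in lim (X @ _) = _); set f' := (X in _ = lim (X @ _)).
suff -> : f = f' by [].
by apply/funext => h; rewrite /f /f' /= l0 addr0 /GRing.scale /= mulr1.
Qed.

Lemma hamiltonian_vector_diff (x X v : state R) :
  phase_space x -> hamiltonian_vector x X -> tangent x v ->
  hamiltonian_diff x v = omega X v.
Proof. by move=> xP [_ HX] /HX ->; rewrite derive_hamiltonian. Qed.

(** [X] is itself tangent, so it can be paired with itself, and [omega] is antisymmetric. *)
Lemma hamiltonian_diff_vector (x X : state R) :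
  phase_space x -> hamiltonian_vector x X -> hamiltonian_diff x X = 0.
Proof.
move=> xP HX; rewrite (hamiltonian_vector_diff _ _ _ xP HX); last by case: HX.
by rewrite /omega (dotC _ (pos1 X)) (dotC _ (pos2 X)); ring.
Qed.

(* The infinitesimal rotation with axis [e] is the Hamiltonian vector field of
   the component of the angular momentum along [e]. *)
Lemma angular_momentum_diff_vector (x X : state R) (e : 'rV[R]_3) :
  phase_space x -> hamiltonian_vector x X ->
  dot (cross (pos1 X) (mom1 x) + cross (pos1 x) (mom1 X) +
       (cross (pos2 X) (mom2 x) + cross (pos2 x) (mom2 X))) e = 0.
Proof.
move=> xP HX.
pose v : state R := ((cross e (pos1 x), cross e (pos2 x)),
                     (cross e (mom1 x), cross e (mom2 x))).
have vP : tangent x v.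
  by split; rewrite /v /pos1 /pos2 /mom1 /mom2 /= !coordE; ring.
have /eqP := hamiltonian_vector_diff _ _ _ xP HX vP.
rewrite -subr_eq0 /hamiltonian_diff /omega /v /pos1 /pos2 /mom1 /mom2 /=.
(* With [k] opaque, what remains is a polynomial identity: dH(v) vanishes by rotation invariance,
   and -omega(X, v) is the variation of <L, e> along [X]. *)
set k := derive _ _ _; rewrite !coordE => /eqP <-.
ring.
Qed.

End Curves.

(** * From derivatives within the time interval to ordinary ones *)

Section Solutions.
Variable R : realType.

Lemma is_derive_slope (f : R -> R) (t l : R) :
  (fun s => (s - t)^-1 * (f s - f t)) @ t^' --> l -> is_derive t 1 f l.
Proof.
move=> fl.
(* The substitution s = h + t turns the slope into the quotient that defines [derive]. *)
have sh : h + t @[h --> (0 : R)^'] --> t^'.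
  move=> A tA.
  have st : h + t @[h --> (0 : R)] --> t.
    rewrite -[X in _ --> X]add0r.
    by apply: cvgD; [exact: cvg_id | exact: cvg_cst].
  have := st _ tA; rewrite !nbhs_simpl /=.
  apply: filterS => h /= hA h0; apply: hA.
  by rewrite addrC -subr_eq0 addrAC subrr add0r.
have := cvg_comp _ _ sh fl.
set F := (X in X @ _ --> _) => Fl.
have e : F = (fun h : R => h^-1 *: ((f \o shift t) (h *: 1) - f t)).
  by apply/funext => h; rewrite /F /= addrK /GRing.scale /= mulr1.
rewrite e in Fl.
by apply: DeriveDef; [apply: cvgP Fl | exact: cvg_lim Fl].
Qed.

(** Serves with [F] the two-sided punctured filter at interior times and the right-sided one at time
    0. Linearity of [p] is asked in the shape of a difference quotient, where it holds by
    computation for the four projections. *)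
Lemma within_derivative_coord (D : set R) g (t : R) (X : state R) (F : set_system R) :
  F `=>` within D t^' -> has_derivative_within D g t X ->
  forall (p : state R -> 'rV[R]_3),
    (forall (a : R) x y, p (a *: (x - y)) = a *: (p x - p y)) -> continuous p ->
  forall i, (fun s => (s - t)^-1 * (p (g s) 0 i - p (g t) 0 i)) @ F --> p X 0 i.
Proof.
move=> FD gX p pl pc i.
have pX := cvg_comp _ _ gX (pc X).
have fX : (fun s => p ((s - t)^-1 *: (g s - g t)) 0 i) @ within D t^' --> p X 0 i.
  exact: cvg_comp _ _ pX (@coord_continuous R 1 3 0 i (p X)).
have <- : (fun s => p ((s - t)^-1 *: (g s - g t)) 0 i) =
    (fun s => (s - t)^-1 * (p (g s) 0 i - p (g t) 0 i)).
  by apply/funext => s; rewrite pl !mxE.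
exact: cvg_trans (cvg_app _ FD) fX.
Qed.

Lemma pos1_continuous : continuous (@pos1 R).
Proof. by move=> x; apply: cvg_comp; exact: cvg_fst. Qed.

Lemma pos2_continuous : continuous (@pos2 R).
Proof. by move=> x; apply: cvg_comp; [exact: cvg_fst|exact: cvg_snd]. Qed.

Lemma mom1_continuous : continuous (@mom1 R).
Proof. by move=> x; apply: cvg_comp; [exact: cvg_snd|exact: cvg_fst]. Qed.

Lemma mom2_continuous : continuous (@mom2 R).
Proof. by move=> x; apply: cvg_comp; exact: cvg_snd. Qed.


(** Replaces [T], finite or not, by a real bound, so that later neighbourhood arguments need no case
    analysis. *)
Lemma time_interval_sub (T : \bar R) (t : R) : (t%:E < T)%E ->
  exists2 b, t < b & forall s, 0 <= s -> s < b -> time_interval T s.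
Proof.
case: T => [r| |]//; rewrite ?lte_fin => tr.
- by exists r => // s s0 sr; split; rewrite ?lte_fin.
- by exists (t + 1) => [|s s0 _]; [rewrite ltrDl|split; rewrite // ltry].
Qed.

Lemma is_derive_solution (T : \bar R) g (t : R) :
  is_solution T g -> 0 < t -> (t%:E < T)%E ->
  phase_space (g t) /\
  exists2 X, hamiltonian_vector (g t) X & is_derive_state _ t g X.
Proof.
move=> gT t0 tT; have [] := gT t; first by split; [exact: ltW|].
move=> gP [X HX gX]; split=> //; exists X => //.
(* Since 0 < t < T, a whole neighbourhood of [t] lies in the time interval, so the restricted
   derivative is two-sided. *)
have tD : t^' `=>` within (time_interval T) t^'.
  have [b tb bT] := time_interval_sub _ _ tT.
  have tb' : t \in `]0, b[ by rewrite in_itv/= t0.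
  have N : \forall s \near t, s \in `]0, b[ := near_in_itvoo tb'.
  move=> A AD; apply: filterS2 N AD => s.
  rewrite in_itv/= => /andP[s0 sb] sA st.
  by apply: sA => //; apply: bT => //; exact: ltW.
have C := within_derivative_coord _ _ _ _ _ tD gX.
split=> i; apply: is_derive_slope; apply: C => //.
- exact: pos1_continuous.
- exact: pos2_continuous.
- exact: mom1_continuous.
- exact: mom2_continuous.
Qed.

(** Differentiability from the right implies continuity from the right: f(s) is s times the slope,
    plus f(0). *)
Lemma cvg_slope_at_right (f : R -> R) (l : R) :
  (fun s => (s - 0)^-1 * (f s - f 0)) @ 0^'+ --> l -> f @ 0^'+ --> f 0.
Proof.
move=> fl.
have id0 : (fun s : R => s) @ 0^'+ --> (0 : R) by exact: cvg_within.
have sl : (fun s : R => s * ((s - 0)^-1 * (f s - f 0)) + f 0) @ 0^'+ --> f 0.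
  have := cvgD (cvgM id0 fl) (cvg_cst (f 0)).
  by rewrite mul0r add0r => H; exact: H.
apply: cvg_trans sl; apply: near_eq_cvg.
near=> s; rewrite /= subr0 mulrA divff ?mul1r ?subrK//.
Unshelve. all: by end_near. Qed.

Lemma cvg_dot (F : set_system R) (u v : R -> 'rV[R]_3) (a b : 'rV[R]_3) :
  Filter F ->
  (forall i, (fun s => u s 0 i) @ F --> a 0 i) ->
  (forall i, (fun s => v s 0 i) @ F --> b 0 i) ->
  (fun s => dot (u s) (v s)) @ F --> dot a b.
Proof.
move=> FF ua vb; rewrite dotE; under eq_fun do rewrite dotE.
by do 2?apply: cvgD; apply: cvgM.
Qed.

Lemma cvg_cross (F : set_system R) (u v : R -> 'rV[R]_3) (a b : 'rV[R]_3) :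
  Filter F ->
  (forall i, (fun s => u s 0 i) @ F --> a 0 i) ->
  (forall i, (fun s => v s 0 i) @ F --> b 0 i) ->
  forall i, (fun s => cross (u s) (v s) 0 i) @ F --> cross a b 0 i.
Proof.
move=> FF ua vb i; rewrite mxE; under eq_fun do rewrite mxE.
by apply: cvgB; apply: cvgM.
Qed.

(** At time 0 the derivative is one-sided; right continuity there links the value at [g 0] to the
    values at positive times. *)
Lemma cvg_angular_momentum (T : \bar R) g (e : 'rV[R]_3) :
  is_solution T g -> (0 < T)%E ->
  (fun s => dot (angular_momentum (g s)) e) @ 0^'+
    --> dot (angular_momentum (g 0)) e.
Proof.
move=> gT T0; have [_ [X _ gX]] := gT 0 (conj (lexx _) T0).
have [b b0 bT] := time_interval_sub _ _ T0.
have tD : (0 : R)^'+ `=>` within (time_interval T) 0^'.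
  have N : \forall s \near (0 : R), s < b := lt_nbhsl b0.
  move=> A AD; apply: filterS2 N AD => s sb sA s0.
  by apply: sA; [rewrite gt_eqF|apply: bT => //; exact: ltW].
have C (p : state R -> 'rV[R]_3) pl pc i := cvg_slope_at_right (fun s => p (g s) 0 i) _
  (within_derivative_coord _ _ _ _ _ tD gX p pl pc i).
have C1 := C _ (fun _ _ _ => erefl) (@pos1_continuous).
have C2 := C _ (fun _ _ _ => erefl) (@pos2_continuous).
have C3 := C _ (fun _ _ _ => erefl) (@mom1_continuous).
have C4 := C _ (fun _ _ _ => erefl) (@mom2_continuous).
apply: cvg_dot => i; last exact: cvg_cst.
rewrite mxE; under eq_fun do rewrite mxE.
by apply: cvgD; apply: cvg_cross.
Unshelve. all: by end_near. Qed.

(** * Conservation of energy and angular momentum *)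

Lemma is_derive0_eq (T : \bar R) (f : R -> R) :
  (forall s, 0 < s -> (s%:E < T)%E -> is_derive s 1 f 0) ->
  forall s t, 0 < s -> s < t -> (t%:E < T)%E -> f s = f t.
Proof.
move=> f0 s t s0 st tT.
have d x : x \in `[s, t] -> is_derive x 1 f 0.
  rewrite in_itv/= => /andP[sx xt]; apply: f0; first exact: lt_le_trans sx.
  by apply: le_lt_trans tT; rewrite lee_fin.
have doo x : x \in `]s, t[ -> is_derive x 1 f (cst 0 x).
  by move=> /subset_itv_oo_cc; exact: d.
have fc : {within `[s, t], continuous f}.
  by apply: derivable_within_continuous => x /d [].
have [c _] := MVT_segment (ltW st) doo fc.
by rewrite mul0r => /eqP; rewrite subr_eq0 => /eqP.
Qed.

Lemma hamiltonian_conserved (T : \bar R) g : is_solution T g ->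
  forall s t, 0 < s -> s < t -> (t%:E < T)%E ->
  hamiltonian (g s) = hamiltonian (g t).
Proof.
move=> gT; apply: (is_derive0_eq T (fun s => hamiltonian (g s))) => s s0 sT.
have [gP [X HX dX]] := is_derive_solution _ _ _ gT s0 sT.
apply: is_derive_eq (is_derive_hamiltonian _ _ _ _ gP dX) _.
exact: hamiltonian_diff_vector HX.
Qed.

Lemma angular_momentum_conserved (T : \bar R) g : is_solution T g ->
  forall t e, 0 < t -> (t%:E < T)%E ->
  dot (angular_momentum (g t)) e = dot (angular_momentum (g 0)) e.
Proof.
move=> gT t e t0 tT.
have cst s : 0 < s -> s < t ->
    dot (angular_momentum (g s)) e = dot (angular_momentum (g t)) e.
  move=> s0 st.
  apply: (is_derive0_eq T (fun s => dot (angular_momentum (g s)) e)) tT => //.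
  move=> r r0 rT; have [gP [X HX dX]] := is_derive_solution _ _ _ gT r0 rT.
  apply: is_derive_eq (is_derive_angular_momentum _ _ _ _ e dX) _.
  exact: angular_momentum_diff_vector HX.
have T0 : (0 < T)%E by apply: lt_trans tT; rewrite lte_fin.
have L0 := cvg_angular_momentum T g e gT T0.
(* To the right of 0 the function is constant, equal to its value at [t]; that constant must be its
   limit, the value at 0. *)
apply: (cvg_unique _ _ L0) => //.
apply: cvg_near_cst; near=> s.
apply: cst; near: s; [exact: nbhs_right_gt|exact: nbhs_right_lt].
Unshelve. all: by end_near. Qed.

(** * Energy bound on the heights of the bodies *)

Definition collision_bound (E d : R) : R :=
  2 * (1 - d ^+ 2) * E + 2 * d * Num.sqrt (1 - d ^+ 2).

(** Here [p] is the momentum of the other body [q'], and [K] is the kinetic energy of the body [q].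
    Cauchy-Schwarz for <q x q', p> gives the bound sin^2 q |p|^2, which the energy controls because
    [K] is nonnegative. *)
Lemma height_sqr_le (d E k K : R) (q q' p : 'rV[R]_3) :
  -1 < d < 1 -> dot q q = 1 -> dot q' q' = 1 -> dot q q' = d -> 0 <= K ->
  E = 2^-1 * dot p p + K - cot_acos _ d ->
  dot q (cross q' p) ^+ 2 <= collision_bound E d.
Proof.
move=> d1 q1 q'1 qq' K0 HE.
rewrite dot_crossA; apply: le_trans (dot_sqr_le _ _ _) _.
rewrite dot_cross_sqr q1 q'1 qq' mul1r /collision_bound.
have s2 : Num.sqrt (1 - d ^+ 2) ^+ 2 = 1 - d ^+ 2.
  by rewrite sqr_sqrtr//; case/andP: d1; nra.
have s0 : 0 < Num.sqrt (1 - d ^+ 2).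
  by rewrite sqrtr_gt0; case/andP: d1; nra.
move: HE; rewrite cot_acosE//; move: s2 s0; set s := Num.sqrt _ => <- s0 HE.
(* This is the energy relation multiplied by 2 s^2, where s = sin q and cot q = d / s. *)
have -> : 2 * s ^+ 2 * E + 2 * d * s = s ^+ 2 * dot p p + 2 * s ^+ 2 * K.
  by rewrite HE; field; rewrite gt_eqF.
rewrite lerDl; apply: mulr_ge0 => //; apply: mulr_ge0 => //; exact: sqr_ge0.
Qed.

(** The body's own term q1 x p1 is orthogonal to q1, so only <q1, q2 x p2> contributes to the
    height. *)
Lemma height1_le (x : state R) : phase_space x ->
  dot (pos1 x) (angular_momentum x) ^+ 2 <=
    collision_bound (hamiltonian x) (dot (pos1 x) (pos2 x)).
Proof.
move=> xP; have [[u1 v1] _ _ _] := xP.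
rewrite (dotC _ _ (angular_momentum x)) dotDl -dotC dot_cross_self add0r -dotC.
apply: (height_sqr_le _ _ 0 (2^-1 * dot (mom1 x) (mom1 x))) => //.
- exact: phase_space_dot.
- by rewrite mulr_ge0 ?invr_ge0 ?dot_ge0.
- by rewrite /hamiltonian [2^-1 * _ + _]addrC.
Qed.

Lemma height2_le (x : state R) : phase_space x ->
  dot (pos2 x) (angular_momentum x) ^+ 2 <=
    collision_bound (hamiltonian x) (dot (pos1 x) (pos2 x)).
Proof.
move=> xP; have [[u1 v1] _ _ _] := xP.
rewrite (dotC _ _ (angular_momentum x)) dotDl -[dot (cross (pos2 x) _) _]dotC.
rewrite dot_cross_self addr0 -dotC.
apply: (height_sqr_le _ _ 0 (2^-1 * dot (mom2 x) (mom2 x))) => //.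
- exact: phase_space_dot.
- exact: dotC.
- by rewrite mulr_ge0 ?invr_ge0 ?dot_ge0.
Qed.

(** * Limits at the collision time *)

Lemma cvg_collision_bound (F : set_system R) (E : R) (d : R -> R) :
  Filter F -> d @ F --> (1 : R) ->
  (fun t => Num.sqrt (collision_bound E (d t))) @ F --> (0 : R).
Proof.
move=> FF d1.
have d2 : (fun t => 1 - d t ^+ 2) @ F --> (0 : R).
  rewrite -[X in _ --> X](subrr 1) -[X in _ --> _ - X](expr1n _ 2).
  by apply: cvgB; [exact: cvg_cst|rewrite !expr2; exact: cvgM].
have s2 : (fun t => Num.sqrt (1 - d t ^+ 2)) @ F --> (0 : R).
  by rewrite -[X in _ --> X](sqrtr0 R); exact: cvg_comp d2 (@sqrt_continuous R 0).
have bE : (fun t => collision_bound E (d t)) @ F --> (0 : R).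
  have := cvgD (cvgM (cvgM (cvg_cst (2 : R)) d2) (cvg_cst E))
               (cvgM (cvgM (cvg_cst (2 : R)) d1) s2).
  by rewrite !mulr0 mul0r addr0 => H; exact: H.
rewrite -[X in _ --> X](sqrtr0 R); exact: cvg_comp bE (@sqrt_continuous R 0).
Qed.

Lemma filter_to_time (T : \bar R) : Filter (to_time T).
Proof. by case: T => [r| |]; rewrite /to_time; typeclasses eauto. Qed.

Lemma near_to_time (T : \bar R) (a : R) : (a%:E < T)%E ->
  \forall t \near to_time T, a < t /\ (t%:E < T)%E.
Proof.
case: T => [r| |]//= aT.
- rewrite lte_fin in aT.
  have rt : \forall t \near r^'-, t < r by exact: withinT.
  by apply: filterS2 (nbhs_left_gt aT) rt => t at_ tr; rewrite lte_fin.
- have : \forall t \near +oo%R, a < t by exact: nbhs_pinfty_gt.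
  by apply: filterS => t at_; split; rewrite // ltry.
Qed.

End Solutions.

Theorem mainTheorem5 (R : realType) (T : \bar R) (g : R -> state R)
    (L : 'rV[R]_3) :
  is_collision_trajectory T g ->
  L = angular_momentum (g 0) ->
  L != 0 ->
  (fun t : R => dot (pos1 (g t)) L) @ to_time T --> (0 : R) /\
  (fun t : R => dot (pos2 (g t)) L) @ to_time T --> (0 : R).
Proof.
move=> [T0 gT q0] LE _.
have FT := filter_to_time _ T.
have [b b0 bT] := time_interval_sub _ _ _ T0.
(* The energy is compared with its value at a reference time, taken positive because conservation is
   proved between positive times. *)
have a0 : 0 < b / 2 by rewrite divr_gt0.
have [_ aT] : time_interval T (b / 2).
  by apply: bT; [exact: ltW|rewrite ltr_pdivrMr// ltr_pMr// ltr1n].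
set a := b / 2 in a0 aT.
have nT := near_to_time _ _ _ aT.
pose d t := dot (pos1 (g t)) (pos2 (g t)).
have d1 : d @ to_time T --> (1 : R).
  pose w t := pos1 (g t) - pos2 (g t).
  have w0 i : (fun t => w t 0 i) @ to_time T --> (0 : 'rV[R]_3) 0 i.
    exact: cvg_comp q0 (@coord_continuous R 1 3 0 i 0).
  (* For unit vectors <q1, q2> = 1 - |q1 - q2|^2 / 2, so the collision forces cos q to tend to 1. *)
  have dw : (fun t => 1 - 2^-1 * dot (w t) (w t)) @ to_time T --> (1 : R).
    have := cvgB (cvg_cst (1 : R)) (cvgM (cvg_cst (2^-1 : R)) (cvg_dot _ _ _ _ _ _ FT w0 w0)).
    by rewrite [dot 0 0]dotE !mxE !mulr0 !addr0 mulr0 subr0 => H; exact: H.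
  apply: cvg_trans dw; apply: near_eq_cvg.
  apply: filterS nT => t [at_ tT].
  have [[[u1 v1] _ _ _] _] := is_derive_solution _ _ _ _ gT (lt_trans a0 at_) tT.
  rewrite /w /d /=; move: u1 v1; rewrite !coordE; lra.
have sE := cvg_collision_bound _ _ (hamiltonian (g a)) d FT d1.
have main (p : state R -> 'rV[R]_3) : (forall x, phase_space x ->
    dot (p x) (angular_momentum x) ^+ 2 <=
      collision_bound _ (hamiltonian x) (dot (pos1 x) (pos2 x))) ->
    (fun t => dot (p (g t)) L) @ to_time T --> (0 : R).
  move=> pb; apply: norm_cvg0.
  apply: (squeeze_cvgr _ (cvg_cst 0) sE).
  apply: filterS nT => t [at_ tT]; rewrite normr_ge0 /=.
  have t0 := lt_trans a0 at_.
  have [gP _] := is_derive_solution _ _ _ _ gT t0 tT.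
  (* The absolute value is the root of the square, so the bound on squared heights suffices.
     Conservation of L is then used with [e] the current position [p (g t)], and the energy is moved
     from [a] to [t]. *)
  rewrite -sqrtr_sqr ler_wsqrtr// LE dotC.
  rewrite -(angular_momentum_conserved _ _ _ gT _ _ t0 tT) dotC.
  by rewrite (hamiltonian_conserved _ _ _ gT _ _ a0 at_ tT); exact: pb.
by split; apply: main => x; [exact: height1_le|exact: height2_le].
Qed.
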